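(* Let $p \geq 11$ be a prime. Then for every real number $n \geq 2p$, \[\Phi(n,p) \geq \left\lfloor \frac{2n}{p} \right\rfloor + 1.\]
   Context: For real numbers $x$ and $y$, $\Phi(x,y)$ denotes the number of positive integers at most $x$ having no prime factor less than $y$ (in particular the integer $1$ is counted). *)

(* Defs.v *)
From HB Require Import structures.
From mathcomp Require Import all_boot all_order all_algebra.
From mathcomp Require Import reals.
Set Implicit Arguments. Unset Strict Implicit. Unset Printing Implicit Defensive.
Import Order.TTheory GRing.Theory Num.Theory.
Local Open Scope ring_scope.

Definition no_prime_factor_lt (R : realType) (y : R) (k : nat) : bool :=
  all (fun q : nat => ~~ (q%:R < y)) (primes k).

(* [Num.truncn x] is the integer part of [x] when [0 <= x] and [0] otherwise,
   so [iota 1 (Num.truncn x)] lists the positive integers at most [x]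
   (see [mem_iota_truncn]). *)
Definition Phi (R : realType) (x y : R) : nat :=
  count (no_prime_factor_lt y) (iota 1 (Num.truncn x)).

Lemma mem_iota_truncn (R : realType) (x : R) (k : nat) :
  (k \in iota 1 (Num.truncn x)) = (0 < k)%N && (k%:R <= x).
Proof.
by rewrite mem_iota add1n ltnS; case: k => [//|k] /=; rewrite truncn_gt_nat.
Qed.

Lemma no_prime_factor_ltP (R : realType) (y : R) (k : nat) : (0 < k)%N ->
  reflect (forall q : nat, prime q -> (q %| k)%N -> ~ (q%:R < y))
          (no_prime_factor_lt y k).
Proof.
move=> k0; apply: (iffP allP) => [h q pq qk|h q].
  by apply/negP/h; rewrite mem_primes pq k0.
by rewrite mem_primes => /and3P[pq _ qk]; apply/negP/h.
Qed.

(* Main.v *)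
Require Import Defs.
From Stdlib Require Import PeanoNat NArith.
From HB Require Import structures.
From mathcomp Require Import all_boot all_order all_algebra zify ring lra.
From mathcomp Require Import reals.
Set Implicit Arguments. Unset Strict Implicit. Unset Printing Implicit Defensive.
Import Order.TTheory GRing.Theory Num.Theory.

(** Writing [N] for the integer part of [n], one has to find more than
    [(2N+1)/p] integers up to [N] without prime factor below [p].  Three
    regimes cover all [N >= 2p].

    - For [N] large compared with [p] (roughly [N > p 2^e / 4], where [e] is the
      number of primes in [[7, p)]), Legendre's sieve, started from the exact
      count modulo 30, gives at least [W N - 2^e] such integers, where
      [W = prod_(q < p) (1 - 1/q)] exceeds [6/p] once [p >= 41]; moreover
      [e <= 4p/15].
    - Below that, [log2 N] is at most [3p/8] and the primes in [[p, N]] suffice: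
      Erdos' argument on the central binomial coefficient of [2m ~ N] bounds the
      part of it supported on primes below [p] by
      [(2m)^sqrt(2m) * 4^min(p, 2m/3)], which leaves enough primes in [[p, N]].
    - For [p <= 1024] and [N <= 2^14] (for [p < 41], [N <= 3p^2]) the primes in
      [[p, N]] suffice by computation. *)

(** * Small cases by computation *)

(** A composite number below 128^2 has a prime factor below 128, so division by these primes decides
    primality up to 2^14. *)
Definition small_primes : seq N :=
  [:: 2; 3; 5; 7; 11; 13; 17; 19; 23; 29; 31; 37; 41; 43; 47; 53; 59; 61; 67;
      71; 73; 79; 83; 89; 97; 101; 103; 107; 109; 113; 127]%num.

Definition trial_prime (b : N) : bool :=
  all (fun q => (b =? q)%num || ~~ (b mod q =? 0)%num) small_primes.

Fixpoint N_range (b : N) (n : nat) : seq N :=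
  if n is n'.+1 then b :: N_range (N.succ b) n' else [::].

Definition prime_list : seq N :=
  [seq b <- N_range 2 (128 * 128 - 2) | trial_prime b].

(* [l] lists the primes from the [c]-th one at least [p] on; the [c]-th one has
   to be at most [c p / 2] for every [c >= 4] with [c p <= 2 T + 1]. *)
Fixpoint schedule (p T c : N) (l : seq N) : bool :=
  if (2 * T + 1 <? c * p)%num then true else
  if l is b :: l' then
    ((c <=? 3)%num || (2 * b <=? c * p)%num) && schedule p T (N.succ c) l'
  else false.

Definition sweep_bound (p : N) : N := (if p <? 41 then 3 * p * p else 128 * 128)%num.

(** The suffix of the prime list that starts at [p] lists the primes from [p] on, so one traversal
    treats every [p]. *)
Fixpoint schedules (l : seq N) : bool :=
  if l is p :: l' then
   ((p <? 11) || (1024 <? p) || schedule p (sweep_bound p) 1 l)%num && schedules l'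
  else true.

Lemma schedulesE : schedules prime_list.
Proof. by vm_cast_no_check (erefl true). Qed.

Definition prime_count (p N : nat) : nat :=
  count (fun q => prime q && (p <= q)) (iota 1 N).

Lemma prime_count_ge (p N : nat) (s : seq nat) :
  uniq s -> {in s, forall b, [/\ prime b, p <= b & b <= N]} ->
  size s <= prime_count p N.
Proof.
move=> us sP; rewrite /prime_count -size_filter; apply: uniq_leq_size => // b.
by move=> /sP[b_pr pb bN]; rewrite mem_filter mem_iota b_pr pb prime_gt0.
Qed.

Lemma mem_N_range (a : N) (n : nat) (b : N) :
  (b \in N_range a n) = (a <=? b)%num && (b <? a + N.of_nat n)%num.
Proof.
elim: n a => [|n IHn] a; first by rewrite /= in_nil; lia.
by rewrite /= in_cons IHn; case: eqP; lia.
Qed.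

Lemma N_range_sorted (a : N) (n : nat) : sorted N.ltb (N_range a n).
Proof.
by elim: n a => // -[//|n] IHn a; rewrite /= in IHn *; rewrite IHn andbT; lia.
Qed.

Lemma mem_small_primes (q : nat) :
  prime q -> q < 128 -> N.of_nat q \in small_primes.
Proof.
move=> q_pr q_lt.
suff: all (fun q => prime q ==> (N.of_nat q \in small_primes)) (iota 0 128).
  by move/allP/(_ q); rewrite mem_iota q_pr; apply.
by vm_compute.
Qed.

Lemma small_primes_prime (q : N) : q \in small_primes -> prime (N.to_nat q).
Proof. by move: q; apply/allP; vm_compute. Qed.

Lemma N_mod_eq0 (b q : N) : 0 < N.to_nat q ->
  (b mod q =? 0)%num = (N.to_nat q %| N.to_nat b).
Proof.
move=> q_gt0; apply/N.eqb_spec/dvdnP => [/N.Div0.mod_divides[c ->]|[c bE]].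
  by exists (N.to_nat c); lia.
by apply/N.Div0.mod_divides; exists (N.of_nat c); lia.
Qed.

Lemma trial_primeP (b : nat) :
  1 < b < 128 * 128 -> prime b = trial_prime (N.of_nat b).
Proof.
move=> /andP[b_gt1 b_lt]; apply/idP/allP => [b_pr q q_small|b_trial].
  case: N.eqb_spec => //= b_neq; apply/negP => qb.
  have q_pr := small_primes_prime q_small.
  have q_dvd : N.to_nat q %| b by rewrite -[b]Nat2N.id -N_mod_eq0 // prime_gt0.
  move: q_dvd; rewrite dvdn_prime2 // => /eqP; lia.
apply: contraT => /primePns[|[q [q_pr q2 qb]]]; first lia.
have q_lt : q < 128 by move: q2; rewrite -mulnn; nia.
have := b_trial _ (mem_small_primes q_pr q_lt); have := prime_gt1 q_pr.
rewrite N_mod_eq0 ?Nat2N.id ?prime_gt0 // qb orbF => q_gt1 /N.eqb_spec bq.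
by move: q2; rewrite -mulnn; move/Nat2N.inj: bq => ->; nia.
Qed.

Lemma mem_prime_list (b : nat) :
  (N.of_nat b \in prime_list) = prime b && (b < 128 * 128).
Proof.
rewrite mem_filter mem_N_range.
case b_range: (1 < b < 128 * 128).
  rewrite -trial_primeP // (_ : _ < _ = true); last lia.
  by congr (_ && _); lia.
case: (boolP (prime b)) => [/prime_gt1|_]; last by rewrite /=; lia.
lia.
Qed.

Lemma scheduleP (p T c : N) (l : seq N) (i : nat) :
  schedule p T c l -> (4 <= c + N.of_nat i)%num ->
  ((c + N.of_nat i) * p <= 2 * T + 1)%num ->
  i < size l /\ (2 * nth 0%num l i <= (c + N.of_nat i) * p)%num.
Proof.
elim: l c i => [|b l IHl] c i /=; case: N.ltb_spec => //; [nia..|].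
move=> _ /andP[b_le l_sch] c_ge ci.
case: i ci c_ge => [|i] ci c_ge /=; first by split => //; lia.
have succE : (N.succ c + N.of_nat i = c + N.of_nat i.+1)%num by lia.
by have := IHl _ i l_sch; rewrite succE; apply.
Qed.

Lemma schedules_suffix (l1 : seq N) (p : N) (l2 : seq N) :
  (11 <= p <= 1024)%num -> schedules (l1 ++ p :: l2) ->
  schedule p (sweep_bound p) 1 (p :: l2).
Proof.
move=> p_range; elim: l1 => [|q l1 IHl] /= /andP[]; last by [].
by move=> /orP[|//]; lia.
Qed.

(** If [b] is the [k]-th prime from [p] on, the schedule gives [2 b <= k p <= 2 N + 1], hence
    [b <= N]; the first [k] entries are then the primes sought. *)
Lemma prime_count_small (p N : nat) : prime p -> 11 <= p <= 1024 ->
  2 * p <= N -> N <= (if p < 41 then 3 * p * p else 128 * 128) ->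
  (2 * N + 1) %/ p <= prime_count p N.
Proof.
move=> p_pr p_range N_ge N_le; set k := _ %/ p.
have p_mem : N.of_nat p \in prime_list by rewrite mem_prime_list p_pr; lia.
have tr : transitive N.ltb by move=> x y z; lia.
have l_sort : sorted N.ltb prime_list by apply: sorted_filter (N_range_sorted _ _).
have l_sch := schedulesE.
have l_prime b : b \in prime_list -> prime (N.to_nat b).
  by rewrite -{1}(N2Nat.id b) mem_prime_list => /andP[].
case/splitPr: p_mem l_sort l_sch l_prime => l1 l2 l_sort l_sch l_prime.
have {l_sort}[_ l_sort] := cat_sorted2 l_sort.
have {}l_sch := schedules_suffix _ l_sch.
have {}l_prime b : b \in N.of_nat p :: l2 -> prime (N.to_nat b).
  by move=> b_mem; apply: l_prime; rewrite mem_cat b_mem orbT.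
set l := _ :: l2 in l_sort l_sch l_prime.
have kp : k * p <= 2 * N + 1 := leq_trunc_div _ _.
(* This is where [2 p <= N] enters; it lets the schedule leave [c <= 3] unconstrained. *)
have k_ge : 4 <= k by rewrite leq_divRL; lia.
have {}l_sch : schedule (N.of_nat p) (sweep_bound (N.of_nat p)) 1 l by apply: l_sch; lia.
have [||k_lt b_k] := scheduleP (i := k.-1) l_sch; [lia| |].
  by rewrite /sweep_bound; case: N.ltb_spec => ?; move: N_le; case: ifP => ? ?; nia.
have b_N : N.to_nat (nth 0%num l k.-1) <= N by nia.
have -> : k = size (map N.to_nat (take k l)).
  by rewrite size_map size_takel //; lia.
have sub_l b : b \in take k l -> b \in l by apply: mem_take.
apply: prime_count_ge => [|_ /mapP[b b_mem ->]].
  rewrite (map_inj_uniq N2Nat.inj) take_uniq //.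
  by apply: sorted_uniq l_sort => // x; lia.
split; first exact/l_prime/sub_l.
  have := sub_l _ b_mem; rewrite in_cons => /orP[/eqP->|b_l2]; first lia.
  have /(order_path_min tr) /allP/(_ b b_l2) : path N.ltb (N.of_nat p) l2 by [].
  lia.
apply: leq_trans b_N; have /(nthP 0%num)[i] := b_mem.
rewrite size_takel ?(leq_trans _ k_lt) ?leqSpred // => i_k.
rewrite nth_take // => <-.
have [->//|i_neq] := eqVneq i k.-1.
have i_lt : i < k.-1 by lia.
have ltb_leq x y : (x <? y)%num -> N.to_nat x <= N.to_nat y by lia.
apply: ltb_leq; apply: (sorted_ltn_nth tr 0%num l_sort) (i_lt) => //.
exact: ltn_trans i_lt k_lt.
Qed.

(** * Primes from the central binomial coefficient *)

(** From [M] to [M + 1] the right-hand side is multiplied by 2(2M + 1)/M, which exceeds 4. *)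
Lemma central_bin_ge (m : nat) : 0 < m -> 4 ^ m <= 2 * m * 'C(2 * m, m).
Proof.
case: m => // m _; elim: m => [|m IHm]; first by vm_compute.
set M := m.+1 in IHm *.
have diag := mul_bin_diag (2 * M.+1) M; have down := mul_bin_down (2 * M + 1) M.
rewrite (_ : (2 * M.+1).-1 = 2 * M + 1) in diag; last lia.
rewrite (_ : (2 * M + 1).-1 = 2 * M) in down; last lia.
rewrite (_ : 2 * M + 1 - M = M.+1) in down; last lia.
rewrite expnS; nia.
Qed.

Lemma dvdn_prod_primes (s : seq nat) (P : pred nat) (n : nat) :
  uniq s -> {in s, forall q, P q -> prime q && (q %| n)} ->
  \prod_(q <- s | P q) q %| n.
Proof.
elim: s n => [|q s IHs] n /=; first by rewrite big_nil dvd1n.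
move=> /andP[q_notin s_uniq] sP; rewrite big_cons; case: ifP => Pq; last first.
  by apply: IHs => // r r_s; apply: sP; rewrite in_cons r_s orbT.
have /andP[q_pr q_n] := sP q (mem_head _ _) Pq.
rewrite Gauss_dvd ?q_n ?IHs // => [r r_s|].
  by apply: sP; rewrite in_cons r_s orbT.
rewrite prime_coprime // Euclid_dvd_prod //.
rewrite big_has_cond.
apply/hasPn => r r_s /=; apply/negP => /andP[Pr].
have /andP[r_pr _] : prime r && (r %| n).
  by apply: sP => //; rewrite in_cons r_s orbT.
by rewrite dvdn_prime2 // => /eqP qr; rewrite qr r_s in q_notin.
Qed.

(** * The product of the primes up to n *)

Definition primorial (n : nat) : nat := \prod_(0 <= q < n.+1 | prime q) q.

Lemma near_central_bin_le (m : nat) : 'C(2 * m + 1, m) <= 4 ^ m.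
Proof.
elim: m => [|m IHm] //.
have diag := mul_bin_diag (2 * m + 3) m; have down := mul_bin_down (2 * m + 2) m.
rewrite (_ : (2 * m + 3).-1 = 2 * m + 2) in diag; last lia.
rewrite (_ : (2 * m + 2).-1 = 2 * m + 1) in down; last lia.
rewrite (_ : 2 * m + 2 - m = m + 2) in down; last lia.
rewrite expnS (_ : 2 * m.+1 + 1 = 2 * m + 3); last lia.
(* The ratio 2(2m + 3)/(m + 2) of consecutive terms is below 4. *)
have ratio : (m + 2) * 'C(2 * m + 3, m.+1) = 2 * (2 * m + 3) * 'C(2 * m + 1, m).
  apply/eqP; rewrite -(eqn_pmul2l (ltn0Sn m)) mulnCA -diag mulnCA -down.
  by apply/eqP; lia.
by rewrite -(leq_pmul2l (ltn0Sn m.+1)); nia.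
Qed.

Lemma prime_dvd_fact (q n : nat) : prime q -> (q %| n`!) = (q <= n).
Proof.
move=> q_pr; apply/idP/idP => [|qn]; last by rewrite dvdn_fact ?prime_gt0.
elim: n => [|n IHn]; first by rewrite fact0 Euclid_dvd1.
rewrite factS Euclid_dvdM // => /orP[/dvdn_leq-> //|/IHn]; lia.
Qed.

(** For [n = 2 m + 1], the primes in [m + 2, 2m + 1] divide ['C(2 * m + 1, m)], which is at most
    4^m, and induction bounds the others by 4^(m + 1). An even [n > 2] adds no prime. *)
Lemma primorial_le (n : nat) : primorial n <= 4 ^ n.
Proof.
elim/ltn_ind: n => n IHn; have [n_le2|n_gt2] := leqP n 2.
  by case: n n_le2 {IHn} => [|[|[|//]]] _; rewrite /primorial unlock.
have [n_odd|n_even] := boolP (odd n); last first.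
  have n_gt0 : 0 < n by lia.
  have nP : prime n = false by apply/negP => /even_prime[|]; lia.
  rewrite /primorial big_mkcond big_nat_recr //= nP muln1 -big_mkcond /=.
  rewrite -(prednK n_gt0) -/(primorial n.-1).
  by rewrite (leq_trans (IHn _ _)) ?leq_pexp2l ?prednK //; lia.
have [m nE] : exists m, n = 2 * m + 1.
  by exists n./2; rewrite -{1}(odd_double_half n) n_odd; lia.
rewrite /primorial (@big_cat_nat _ _ _ m.+2) //=; last lia.
rewrite nE (_ : 2 * m + 1 = m.+1 + m) ?expnD; last lia.
rewrite leq_mul ?IHn //; first lia.
apply: leq_trans (near_central_bin_le m).
rewrite dvdn_leq ?bin_gt0 //; first lia.
apply: dvdn_prod_primes => [|q]; first exact: iota_uniq.
rewrite mem_index_iota => q_range q_pr; rewrite q_pr /=.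
have : q %| (2 * m + 1)`! by rewrite prime_dvd_fact //; lia.
rewrite -(@bin_fact _ m); last lia.
by rewrite !Euclid_dvdM // !prime_dvd_fact //; lia.
Qed.

(** Legendre's formula applied to (2m)! = C(2m, m) m! m!; the sum for m! is padded with zero terms
    up to 2m so that the sums subtract termwise. *)
Lemma logn_central_bin (m q : nat) : prime q ->
  logn q 'C(2 * m, m) =
  \sum_(1 <= k < (2 * m).+1) ((2 * m) %/ q ^ k - 2 * (m %/ q ^ k)).
Proof.
move=> q_pr; have m_le : m <= 2 * m by lia.
have := congr1 (logn q) (bin_fact m_le).
rewrite (_ : 2 * m - m = m); last lia.
rewrite !lognM ?muln_gt0 ?fact_gt0 ?bin_gt0 // !logn_fact //.
have -> : \sum_(1 <= k < m.+1) m %/ q ^ k = \sum_(1 <= k < (2 * m).+1) m %/ q ^ k.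
  rewrite [RHS](@big_cat_nat _ _ _ m.+1) //=.
  rewrite [X in _ + X]big_nat_cond [X in _ + X]big1 ?addn0 //.
  move=> k /andP[/andP[mk _] _].
  by rewrite divn_small // (leq_trans mk) // ltnW // ltn_expl // prime_gt1.
rewrite addnn -mul2n big_distrr /= => vE.
apply/eqP; rewrite -(eqn_add2r (\sum_(1 <= k < (2 * m).+1) 2 * (m %/ q ^ k))).
rewrite {}vE -big_split /=; apply/eqP/eq_big_nat => k _.
rewrite subnK // mulnC leq_divRL ?expn_gt0 ?prime_gt0 // mulnAC mulnC leq_mul2l.
exact: leq_trunc_div.
Qed.

(** In Legendre's sum each term is at most 1 and vanishes once q^k exceeds 2m. *)
Lemma logn_central_bin_le (m q : nat) : prime q -> 0 < m ->
  logn q 'C(2 * m, m) <= trunc_log q (2 * m).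
Proof.
move=> q_pr m_gt0; have q_gt1 := prime_gt1 q_pr.
rewrite logn_central_bin //; set t := trunc_log _ _.
have t_le : t <= 2 * m.
  by apply: leq_trans (trunc_logP q_gt1 _); [apply/ltnW/ltn_expl|lia].
rewrite (@big_cat_nat _ _ _ t.+1) //=.
rewrite [X in _ + X]big_nat_cond [X in _ + X]big1 => [|k /andP[/andP[tk _] _]].
  rewrite addn0 -[leqRHS]muln1 -[t in leqRHS](subn1 t.+1) -sum_nat_const_nat.
  apply: leq_sum => k _; rewrite leq_subLR -ltnS ltn_divLR ?expn_gt0 ?prime_gt0 //.
  have qk_gt0 : 0 < q ^ k by rewrite expn_gt0 prime_gt0.
  by have := ltn_ceil m qk_gt0; rewrite mulSn => m_lt; rewrite addn1 !mulSn; nia.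
rewrite divn_small //.
by apply: leq_trans (trunc_log_ltn _ q_gt1) _; rewrite leq_exp2l.
Qed.

(* [(2m) %/ q = 2 = 2 * (m %/ q)], and higher powers of [q] exceed [2m]. *)
Lemma logn_central_bin_eq0 (m q : nat) : prime q -> 2 < q -> q <= m ->
  2 * m < 3 * q -> logn q 'C(2 * m, m) = 0.
Proof.
move=> q_pr q_gt2 q_le q_gt; rewrite logn_central_bin //.
have q_gt0 : 0 < q by lia.
rewrite big_nat_cond big1 // => -[//|[|k]] _.
  rewrite expn1; have -> : m %/ q = 1.
    by apply/eqP; rewrite eqn_leq -ltnS ltn_divLR // leq_divRL //; lia.
  by apply/eqP; rewrite subn_eq0 -ltnS ltn_divLR //; lia.
rewrite divn_small // !expnS; apply: leq_trans q_gt _.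
rewrite mulnC leq_mul2l mulnC; apply/orP; right; apply: leq_trans q_gt2 _.
by rewrite leq_pmull // expn_gt0 q_gt0.
Qed.

Lemma central_bin_prod (m : nat) :
  'C(2 * m, m) = \prod_(0 <= q < (2 * m).+1) q ^ logn q 'C(2 * m, m).
Proof.
have C_gt0 : 0 < 'C(2 * m, m) by rewrite bin_gt0; lia.
have dvd_le q : q \in primes 'C(2 * m, m) -> q <= 2 * m.
  rewrite mem_primes => /and3P[q_pr _ /dvdn_trans q_dvd].
  rewrite -(prime_dvd_fact _ q_pr); apply: q_dvd.
  by rewrite -(@bin_fact (2 * m) m) ?dvdn_mulr //; lia.
rewrite -{1}(partnT C_gt0) (widen_partn _ (leq_addr (2 * m) _)).
rewrite (@big_cat_nat _ _ _ (2 * m).+1) //=; last lia.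
rewrite [X in _ * X]big_nat_cond [X in _ * X]big1 ?muln1 //.
move=> q /andP[/andP[q_gt _] _].
case: (posnP (logn q 'C(2 * m, m))) => [-> //|].
by rewrite logn_gt0 => /dvd_le; lia.
Qed.

(** In C(2m, m), every prime power is at most 2m. Those of primes up to [s] and from [p] on are
    bounded by this ([g1], [g3]); primes between occur at most once and not beyond 2m/3, so
    [primorial_le] bounds their product ([g2]). Compare with [central_bin_ge], whose factor 2m gives
    the summand 1, and take logarithms. *)
Lemma prime_count_lower (p m s L : nat) : 2 < p -> p <= m -> s <= 2 * m ->
  2 * m < s.+1 ^ 2 -> 1 < s -> 2 * m <= 2 ^ L ->
  2 * m <= 2 * minn p.-1 ((2 * m) %/ 3) + L * (1 + s + prime_count p (2 * m)).
Proof.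
move=> p_gt2 p_le s_le s_gt s_gt1 L_ge; set y := minn _ _; set D := prime_count _ _.
have m_gt0 : 0 < m by lia.
pose g1 q := if 0 < q <= s then 2 * m else 1.
pose g2 q := if prime q && (q < y.+1) then q else 1.
pose g3 q := if prime q && (p <= q) then 2 * m else 1.
have g_ge q : q ^ logn q 'C(2 * m, m) <= g1 q * g2 q * g3 q.
  have g2_gt0 : 0 < g2 q by rewrite /g2; case: ifP => // /andP[/prime_gt0].
  have g1_gt0 : 0 < g1 q by rewrite /g1; case: ifP => //; lia.
  have g3_gt0 : 0 < g3 q by rewrite /g3; case: ifP => //; lia.
  have g_gt0 : 0 < g1 q * g2 q * g3 q by rewrite !muln_gt0 g1_gt0 g2_gt0.
  have [q_pr|qNpr] := boolP (prime q); last by rewrite /logn (negPf qNpr).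
  have q_gt1 := prime_gt1 q_pr; have log_le := logn_central_bin_le q_pr m_gt0.
  have pow_le : q ^ logn q 'C(2 * m, m) <= 2 * m.
    apply: leq_trans (trunc_logP q_gt1 _); last lia.
    by rewrite leq_exp2l.
  have [q_s|q_s] := leqP q s.
    have -> : g1 q = 2 * m by rewrite /g1 q_s (ltnW q_gt1).
    by apply: leq_trans pow_le _; rewrite -mulnA leq_pmulr // muln_gt0 g2_gt0.
  have [q_p|q_p] := leqP p q.
    have -> : g3 q = 2 * m by rewrite /g3 q_pr q_p.
    by apply: leq_trans pow_le _; rewrite leq_pmull // muln_gt0 g1_gt0.
  have [q_y|q_y] := leqP q y.
    have -> : g2 q = q by rewrite /g2 q_pr ltnS q_y.
    have log_le1 : logn q 'C(2 * m, m) <= 1.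
      apply: leq_trans log_le _; rewrite -ltnS -(ltn_exp2l _ _ q_gt1).
      apply: leq_ltn_trans (trunc_logP q_gt1 _) _; first lia.
      by apply: leq_trans s_gt _; rewrite leq_exp2r.
    apply: (@leq_trans (q ^ 1)); first by rewrite leq_exp2l.
    by rewrite expn1 mulnAC leq_pmull // muln_gt0 g1_gt0.
  (* Since [y < q < p], the minimum is attained by 2m/3, so 2m/3 < q <= m. *)
  rewrite logn_central_bin_eq0 //; first lia; first lia.
  by move: q_y; rewrite /y gtn_min ltn_divLR //; lia.
have prod_g : \prod_(0 <= q < (2 * m).+1) (g1 q * g2 q * g3 q) <=
    (2 * m) ^ s * 4 ^ y * (2 * m) ^ D.
  rewrite !big_split /= !leq_mul //.
  - rewrite -big_mkcond big_const_seq iter_muln_1; apply: leq_pexp2l; first lia.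
    rewrite -size_filter -(size_iota 1 s); apply: uniq_leq_size.
      by rewrite filter_uniq ?iota_uniq.
    by move=> q; rewrite mem_filter size_iota mem_iota => /andP[].
  - rewrite -big_mkcond -big_nat_widen; first exact: primorial_le.
    by rewrite ltnS geq_min; apply/orP; left; lia.
  - by rewrite -big_mkcond big_const_seq iter_muln_1; apply: leq_pexp2l => //; lia.
have := central_bin_ge m_gt0; rewrite central_bin_prod.
have := leq_trans (leq_prod (fun q _ => g_ge q)) prod_g.
move=> C_le /leq_trans/(_ (leq_mul (leqnn _) C_le)).
have -> : 2 * m * ((2 * m) ^ s * 4 ^ y * (2 * m) ^ D) =
          4 ^ y * (2 * m) ^ (1 + s + D) by rewrite !expnD expn1; lia.
have pow_le := leq_exp2r (2 * m) (2 ^ L) (isT : 0 < 1 + s + D).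
move=> le4; have : 4 ^ m <= 4 ^ y * (2 ^ L) ^ (1 + s + D).
  by apply: leq_trans le4 _; rewrite leq_mul2l pow_le L_ge orbT.
by rewrite -[4]/(2 ^ 2) -!expnM -expnD leq_exp2l.
Qed.

(** * Legendre's sieve *)

Definition rough (p k : nat) : bool := all (leq p) (primes k).

Definition sift (s : seq nat) (N : nat) : nat :=
  count (fun k => all (fun q => ~~ (q %| k)) s) (iota 1 N).

Lemma siftS (s : seq nat) (N : nat) :
  sift s N.+1 = sift s N + all (fun q => ~~ (q %| N.+1)) s.
Proof.
have -> : N.+1 = (N + 1)%N by rewrite addn1.
by rewrite /sift iotaD count_cat /= add1n addn0 addn1.
Qed.

(** The survivors of [s] that [q] removes are the [q j] with [j <= N %/ q], and [q j] survives [s]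
    exactly when [j] does, [q] being a prime outside [s]. *)
Lemma sift_cons (q : nat) (s : seq nat) (N : nat) :
  prime q -> all prime s -> q \notin s ->
  sift (q :: s) N + sift s (N %/ q) = sift s N.
Proof.
move=> q_pr /allP s_pr q_s; have q_gt0 := prime_gt0 q_pr.
elim: N => [|N IHN]; first by rewrite div0n.
rewrite !siftS /= divnS // -IHN; case: (boolP (q %| N.+1)) => [/dvdnP[c NE]|_] /=.
  have -> : N %/ q = c.-1.
    apply/eqP; rewrite eqn_leq -ltnS ltn_divLR // leq_divRL //.
    by case: c NE => [|c] //=; rewrite mulSn; lia.
  have c_gt0 : 0 < c by case: c NE.
  rewrite add1n siftS prednK // addn0 addnA; congr (_ + _); congr nat_of_bool.
  apply: eq_in_all => r r_s; rewrite NE Euclid_dvdM ?s_pr //.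
  rewrite (dvdn_prime2 (s_pr _ r_s) q_pr).
  case: eqP => [rq|_]; last by rewrite orbF.
  by rewrite -rq r_s in q_s.
by rewrite add0n addnAC.
Qed.

(** Every 30 consecutive integers contain 8 = 30 * 4/15 that are prime to 30, so checking [N < 30]
    suffices. *)
Lemma sift30 (N : nat) :
  15 * sift [:: 5; 3; 2] N <= 4 * N + 14 /\
  4 * N <= 15 * sift [:: 5; 3; 2] N + 10.
Proof.
elim/ltn_ind: N => N IHN; have [N_lt|N_ge] := ltnP N 30.
  suff: all (fun N => (15 * sift [:: 5; 3; 2] N <= 4 * N + 14) &&
    (4 * N <= 15 * sift [:: 5; 3; 2] N + 10)) (iota 0 30).
    by move/allP/(_ N); rewrite mem_iota => /(_ N_lt)/andP.
  by vm_compute.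
have [] := IHN (N - 30); first lia.
suff -> : sift [:: 5; 3; 2] N = 8 + sift [:: 5; 3; 2] (N - 30) by lia.
rewrite -{1}(subnKC N_ge).
rewrite /sift iotaD count_cat; congr (_ + _).
rewrite addnC iotaDl count_map; apply: eq_count => k /=.
by rewrite !dvdn_addr.
Qed.

Local Open Scope ring_scope.

(* The factor 4/15 accounts for the primes 2, 3 and 5. *)
Definition density (F : realFieldType) (s : seq nat) : F :=
  4%:R / 15%:R * \prod_(q <- s) (1 - q%:R^-1).

(** By [sift_cons], each prime [q] adds the error at divisor [d q] to the one at [d], doubling the
    bound; hence the induction over all [d]. *)
Lemma legendre (F : realFieldType) (s : seq nat) (N d : nat) :
  uniq (s ++ [:: 5; 3; 2]%N) -> all prime s -> (0 < d)%N ->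
  `|(sift (s ++ [:: 5; 3; 2]%N) (N %/ d))%:R - density F s * (N%:R / d%:R)|
    <= 2 ^+ size s :> F.
Proof.
elim: s d => [|q s IHs] d.
  move=> _ _ d_gt0; rewrite /density big_nil mulr1 expr0 cat0s.
  have [up lo] := sift30 (N %/ d); move: up lo; set S := sift _ _ => up lo.
  have d_gt0R : 0 < d%:R :> F by rewrite ltr0n.
  have low : (N %/ d)%:R <= N%:R / d%:R :> F.
    by rewrite ler_pdivlMr // -natrM ler_nat leq_trunc_div.
  have high : N%:R / d%:R <= (N %/ d)%:R + 1 :> F.
    by rewrite ler_pdivrMr // natr1 -natrM ler_nat ltnW // ltn_ceil.
  have {}up : 15 * S%:R <= 4 * (N %/ d)%:R + 14 :> F.
    by rewrite -!natrM -natrD ler_nat.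
  have {}lo : 4 * (N %/ d)%:R <= 15 * S%:R + 10 :> F.
    by rewrite -!natrM -natrD ler_nat.
  (* Rounding [N / d] down costs at most 4/15 on top of the 10/15 of the lower bound, so the error
     stays below 1. *)
  rewrite ler_norml; lra.
rewrite cat_cons => /andP[q_s s_uniq] /andP[q_pr s_pr] d_gt0.
have q_gt0 := prime_gt0 q_pr.
have s_pr' : all prime (s ++ [:: 5; 3; 2]%N) by rewrite all_cat; apply/andP.
have h1 := IHs _ s_uniq s_pr d_gt0.
have h2 := IHs (d * q)%N s_uniq s_pr ltac:(by rewrite muln_gt0 d_gt0).
move: h1 h2; rewrite -(sift_cons _ q_pr s_pr' q_s) natrD -divnMA.
rewrite /density big_cons natrM invfM exprS -/(density F s).
set a := (sift _ _)%:R; set b := (sift _ _)%:R; set P := \prod_(_ <- _) _.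
set E := 2 ^+ _; move=> h1 h2.
have -> : a - 4%:R / 15%:R * ((1 - q%:R^-1) * P) * (N%:R / d%:R) =
  (a + b - 4%:R / 15%:R * P * (N%:R / d%:R)) -
  (b - 4%:R / 15%:R * P * (N%:R * (d%:R^-1 * q%:R^-1))) by ring.
apply: le_trans (ler_normB _ _) _; lra.
Qed.

(** * The sieving primes and their density *)

Definition sieve_primes (x : nat) : seq nat := [seq q <- index_iota 7 x | prime q].

Lemma sieve_primes_uniq (x : nat) : uniq (sieve_primes x ++ [:: 5; 3; 2]%N).
Proof.
rewrite cat_uniq filter_uniq ?iota_uniq //= andbT !mem_filter !mem_index_iota.
by [].
Qed.

Lemma sieve_primesP (x q : nat) : (5 < x)%N ->
  (q \in sieve_primes x ++ [:: 5; 3; 2]%N) = prime q && (q < x)%N.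
Proof.
move=> x_gt5; rewrite mem_cat mem_filter mem_index_iota !inE.
have [q_ge|] := leqP 7 q; first by case: (prime q) => //=; lia.
by case: q => [|[|[|[|[|[|[|//]]]]]]] _ //=; lia.
Qed.

Lemma rough_sift (x N : nat) : (5 < x)%N ->
  count (rough x) (iota 1 N) = sift (sieve_primes x ++ [:: 5; 3; 2]%N) N.
Proof.
move=> x_gt5; apply: eq_in_count => k; rewrite mem_iota => /andP[k_gt0 _].
apply/allP/allP => [k_rough q|k_sift q].
  rewrite sieve_primesP // => /andP[q_pr q_lt]; apply/negP => qk.
  by have := k_rough q; rewrite mem_primes q_pr k_gt0 qk leqNgt q_lt => /(_ isT).
rewrite mem_primes => /and3P[q_pr _ qk]; rewrite leqNgt; apply/negP => q_lt.
by have := k_sift q; rewrite sieve_primesP // q_pr q_lt qk => /(_ isT).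
Qed.

(** These primes, together with 1, are distinct integers below [x] prime to 30. *)
Lemma size_sieve_primes (x : nat) : (6 < x)%N ->
  (15 * size (sieve_primes x) <= 4 * x - 5)%N.
Proof.
move=> x_gt6.
suff: ((size (sieve_primes x)).+1 <= sift [:: 5; 3; 2] x.-1)%N.
  by have [] := sift30 x.-1; lia.
rewrite /sift -size_filter -[(size _).+1]/(size (1%N :: sieve_primes x)).
apply: uniq_leq_size => [|q].
  by rewrite /= mem_filter /= filter_uniq ?iota_uniq.
rewrite in_cons => /orP[/eqP->|].
  by rewrite mem_filter mem_iota /= add1n; lia.
rewrite mem_filter mem_index_iota => /andP[q_pr q_range].
by rewrite mem_filter mem_iota /= !dvdn_prime2 //; lia.
Qed.

Lemma density_odd_step (F : realFieldType) (x : nat) : odd x -> (6 < x)%N ->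
  density F (sieve_primes x) * (1 - x%:R^-1) <= density F (sieve_primes x.+2).
Proof.
move=> x_odd x_gt6; have xS : prime x.+1 = false.
  by apply/negP => /even_prime[|]; lia.
have densityE y : density F (sieve_primes y) =
    4%:R / 15%:R * \prod_(7 <= q < y | prime q) (1 - q%:R^-1).
  by rewrite /density big_filter.
rewrite !densityE [in leRHS]big_mkcond /= !big_nat_recr /= ?xS ?mulr1; try lia.
rewrite -big_mkcond /=; set P := \prod_(_ <= _ < _ | _) _.
have P_ge0 : 0 <= P.
  rewrite prodr_ge0 // => q /prime_gt0 q_gt0.
  by rewrite subr_ge0 invf_le1 ?ler1n ?ltr0n.
have x_ge0 : 0 <= x%:R^-1 :> F by rewrite invr_ge0.
have Px_ge0 := mulr_ge0 P_ge0 x_ge0.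
by case: ifP => _; [rewrite mulrA|lra].
Qed.

(* [x * density (sieve_primes x)] is nondecreasing along odd [x], because
   [(x + 2) (1 - 1/x) >= x]. *)
Lemma density_ge (F : realFieldType) (c : F) (x0 x : nat) :
  0 <= c -> (6 < x0)%N -> odd x0 -> odd x -> (x0 <= x)%N ->
  c <= x0%:R * density F (sieve_primes x0) ->
  c <= x%:R * density F (sieve_primes x).
Proof.
move=> c_ge0 x0_gt6 x0_odd x_odd x_ge base.
have [i ->] : exists i, x = (x0 + i.*2)%N by exists ((x - x0)./2); lia.
elim: i {x x_odd x_ge} => [|i IHi]; first by rewrite addn0.
have {}x0_odd : odd (x0 + i.*2) by lia.
have {}x0_gt6 : (6 < x0 + i.*2)%N by lia.
rewrite doubleS !addnS; move: (x0 + i.*2)%N IHi x0_odd x0_gt6 => x IHx x_odd x_gt6.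
have := density_odd_step F x_odd x_gt6.
move: (density F (sieve_primes x.+2)) (density F (sieve_primes x)) IHx => W' W cW W_step.
have x_gt0 : 0 < x%:R :> F by rewrite ltr0n; lia.
have x_ge7 : 7 <= x%:R :> F by rewrite (ler_nat F 7).
apply: le_trans (ler_wpM2l (ler0n _ x.+2) W_step).
rewrite -(ler_pM2r x_gt0).
have -> : x.+2%:R * (W * (1 - x%:R^-1)) * x%:R = (x%:R + 2) * (x%:R - 1) * W.
  by rewrite -addn2 natrD; field; rewrite gt_eqF.
nra.
Qed.

Lemma rough_count_lower (F : realFieldType) (c : F) (x N : nat) : (6 < x)%N ->
  c <= x%:R * density F (sieve_primes x) ->
  c * N%:R <= x%:R * ((count (rough x) (iota 1 N))%:R + 2 ^+ size (sieve_primes x)).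
Proof.
move=> x_gt6 cW; have s_pr : all prime (sieve_primes x) by apply: filter_all.
have := legendre F N (sieve_primes_uniq x) s_pr (isT : (0 < 1)%N).
rewrite -rough_sift ?divn1 ?divr1 1?ltnW //; set C := (count _ _)%:R.
rewrite ler_norml => /andP[C_ge _].
have N_ge0 : 0 <= N%:R :> F by [].
have x_ge0 : 0 <= x%:R :> F by [].
apply: le_trans (ler_wpM2r N_ge0 cW) _; rewrite -mulrA.
by apply: (ler_wpM2l x_ge0); lra.
Qed.

(** * The three regimes *)

Lemma prime_count_rough (p N : nat) : (0 < p)%N -> (0 < N)%N ->
  (prime_count p N < count (rough p) (iota 1 N))%N.
Proof.
case: N => // N p_gt0 _; rewrite /prime_count /= !add0n ltnS.
apply: sub_count => q /andP[q_pr pq].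
by rewrite /rough primes_prime //= pq.
Qed.

Lemma prime_count_mono (p M N : nat) : (M <= N)%N ->
  (prime_count p M <= prime_count p N)%N.
Proof. by move=> /subnKC <-; rewrite /prime_count iotaD count_cat leq_addr. Qed.

(** The fraction a/b is a rational lower bound for [p] times the density, which leaves a condition
    on naturals only. *)
Lemma rough_count_large (F : realFieldType) (a b p N : nat) : (6 < p)%N ->
  a%:R <= b%:R * (p%:R * density F (sieve_primes p)) ->
  (b * (2 * N + 1 + p * 2 ^ size (sieve_primes p)) < a * N)%N ->
  ((2 * N + 1) %/ p < count (rough p) (iota 1 N))%N.
Proof.
move=> p_gt6 ab_W N_large; have p_gt0 : (0 < p)%N by lia.
rewrite ltnNge; apply/negP; rewrite leq_divRL // => C_le.
have C_ge := rough_count_lower N p_gt6 (lexx (p%:R * density F _)).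
have := ler_wpM2l (ler0n F b) C_ge; rewrite mulrA.
apply/negP; rewrite -ltNge; apply: lt_le_trans (ler_wpM2r (ler0n F N) ab_W).
rewrite -natrX -natrD -!natrM ltr_nat; apply: leq_ltn_trans N_large.
by rewrite leq_mul2l mulnDr mulnC leq_add2r C_le orbT.
Qed.

Lemma sieve_primesE (F : realFieldType) (x : nat) (s : seq nat) :
  sieve_primes x == s ->
  density F (sieve_primes x) = 4%:R / 15%:R * \prod_(q <- s) (1 - q%:R^-1).
Proof. by move=> /eqP ->. Qed.

(** At [x = 11] the product is 11 * 4/15 * 6/7 = 88/35, just above 5/2. *)
Lemma density11 (F : realFieldType) (x : nat) : odd x -> (11 <= x)%N ->
  5 <= 2 * (x%:R * density F (sieve_primes x)).
Proof.
move=> x_odd x_ge; have -> : 5 = 2 * (5 / 2) :> F by field.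
rewrite ler_pM2l //; refine (density_ge _ _ _ x_odd x_ge _); [lra|by []|by []|].
by rewrite (@sieve_primesE F 11 [:: 7]%N) // !big_cons big_nil; lra.
Qed.

Lemma density29 (F : realFieldType) (x : nat) : odd x -> (29 <= x)%N ->
  47 <= 10 * (x%:R * density F (sieve_primes x)).
Proof.
move=> x_odd x_ge; have -> : 47 = 10 * (47 / 10) :> F by field.
rewrite ler_pM2l //; refine (density_ge _ _ _ x_odd x_ge _); [lra|by []|by []|].
rewrite (@sieve_primesE F 29 [:: 7; 11; 13; 17; 19; 23]%N) //.
by rewrite !big_cons big_nil; lra.
Qed.

Lemma density41 (F : realFieldType) (x : nat) : odd x -> (41 <= x)%N ->
  6 <= 1 * (x%:R * density F (sieve_primes x)).
Proof.
move=> x_odd x_ge; rewrite mul1r.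
refine (density_ge _ _ _ x_odd x_ge _); [lra|by []|by []|].
rewrite (@sieve_primesE F 41 [:: 7; 11; 13; 17; 19; 23; 29; 31; 37]%N) //.
by rewrite !big_cons big_nil; lra.
Qed.

Local Open Scope nat_scope.

Lemma rough_count_p_lt41 (p N : nat) : prime p -> 11 <= p < 41 -> 2 * p <= N ->
  (2 * N + 1) %/ p < count (rough p) (iota 1 N).
Proof.
move=> p_pr p_range N_ge; have [N_le|N_gt] := leqP N (3 * p * p).
  apply: leq_ltn_trans (prime_count_rough _ _); [|lia..].
  by apply: prime_count_small => //; [lia|case: ifP; lia].
have p_odd : odd p by case: (even_prime p_pr) => //; lia.
(* The constant 5/2 requires 2(p 2^e + 1) < N, which [N > 3 p^2] ensures only for [p < 29]; the
   constant 47/10 requires 10(p 2^e + 1) < 27 N. *)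
have : if p < 29 then 2 * (p * 2 ^ size (sieve_primes p)).+1 <= 3 * p * p
       else p * 2 ^ size (sieve_primes p) < 8 * p * p.
  suff: all (fun p => prime p ==>
      if p < 29 then 2 * (p * 2 ^ size (sieve_primes p)).+1 <= 3 * p * p
      else p * 2 ^ size (sieve_primes p) < 8 * p * p) (iota 11 30).
    by move/allP/(_ p); rewrite mem_iota p_pr; apply.
  by vm_compute.
case: ifP => [p_lt|p_ge] size_lt.
  apply: (@rough_count_large rat 5 2); [lia| |lia].
  by apply: density11 => //; lia.
apply: (@rough_count_large rat 47 10); [lia| |lia].
by apply: density29 => //; lia.
Qed.

(** Here 289 = 17^2: when 2^L <= n < (s + 1)^2, taking roots gives 17(L + 1) < 2(s + 1). *)
Lemma expn2_ge_square (L : nat) : 14 <= L -> 289 * (L.+1 * L.+1) <= 4 * 2 ^ L.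
Proof.
move=> /subnKC <-; elim: (L - 14) => [|i IHi]; first by vm_compute.
by rewrite addnS expnS; move: (2 ^ _) IHi => E; nia.
Qed.

Lemma expn2_ge_linear (j : nat) : 6 <= j -> 10 * j + 10 <= 2 ^ j.+1.
Proof.
move=> /subnKC <-; elim: (j - 6) => [|i IHi]; first by vm_compute.
by rewrite addnS expnS; move: (2 ^ _) IHi => E; lia.
Qed.

(* The last hypothesis is the failure of the sieve bound at [N >= 2^(L-1)]. *)
Lemma log_bound (p e L : nat) : 41 <= p -> 15 * e <= 4 * p - 5 ->
  2 ^ L.+1 <= 1 + p * 2 ^ e -> 8 * L <= 3 * p.
Proof.
move=> p_ge e_le L_le.
have {}L_le : 2 ^ L.+1 <= p.+1 * 2 ^ e.
  by rewrite mulSn; apply: leq_trans L_le _; rewrite leq_add2r expn_gt0.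
have log_le t : p.+1 <= 2 ^ t.+1 -> L <= t + e.
  move=> p_le; rewrite -ltnS -addSn -(leq_exp2l (m := 2)) //.
  by apply: leq_trans L_le _; rewrite expnD leq_mul2r p_le orbT.
have [p_lt|p_ge64] := ltnP p 64.
  by have := log_le 5 p_lt; lia.
(* Thus L <= p/10 + e with e <= 4p/15, and 8/10 + 32/15 = 44/15 is below 3. *)
have : 10 * (p %/ 10) + 10 <= 2 ^ (p %/ 10).+1 by apply: expn2_ge_linear; lia.
by move=> p10; have := log_le (p %/ 10); lia.
Qed.

(** Turns a shortage of primes into numerical inequalities to be refuted, with [s] the integer
    square root and [L] the binary logarithm of [n]. *)
Lemma half_prime_count (p N : nat) : 2 < p -> 2 * p <= N ->
  prime_count p N < (2 * N + 1) %/ p ->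
  exists s L k y : nat, let n := 2 * N./2 in
  [/\ s * s <= n < s.+1 * s.+1, 2 ^ L <= n < 2 ^ L.+1, k * p <= 2 * N + 1,
      3 * y <= n /\ y < p & n <= 2 * y + L.+1 * (s + k)].
Proof.
move=> p_gt2 N_ge D_lt; set n := 2 * N./2.
have n_le : n <= N by rewrite /n; lia.
have [s s_n] : exists s, s * s <= n < s.+1 * s.+1.
  by exists (Nat.sqrt n); have := Nat.sqrt_spec' n; lia.
exists s, (trunc_log 2 n), ((2 * N + 1) %/ p), (minn p.-1 (n %/ 3)).
have log_n := trunc_log_bounds (isT : 1 < 2) (_ : 0 < n).
split=> //; [by apply: log_n; lia|exact: leq_trunc_div|by split; lia|].
have n_ge : 6 <= n by rewrite /n; lia.
have s_gt1 : 1 < s by case: s s_n => [|[|]] //; lia.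
have s_le : s <= n.
  by case/andP: s_n => s_n _; apply: leq_trans s_n; rewrite leq_pmulr; lia.
have := @prime_count_lower p N./2 s (trunc_log 2 n).+1 p_gt2 _ s_le _ s_gt1 _.
move=> lower; apply: leq_trans (lower _ _ _) _.
- by lia.
- by rewrite -mulnn; case/andP: s_n.
- by rewrite ltnW // trunc_log_ltn.
rewrite leq_add2l leq_mul2l /=.
(* The strict inequality absorbs the 1 in [1 + s + D]. *)
have := leq_ltn_trans (prime_count_mono p n_le) D_lt; rewrite -/n.
by move: (_ %/ p) (prime_count p n) => k D; lia.
Qed.

Lemma rough_count_p_ge41 (p N : nat) : prime p -> 41 <= p -> 2 * p <= N ->
  (2 * N + 1) %/ p < count (rough p) (iota 1 N).
Proof.
move=> p_pr p_ge N_ge.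
have p_odd : odd p by case: (even_prime p_pr) => //; lia.
have p_gt6 : 6 < p by lia.
set e := size (sieve_primes p).
have [N_large|N_le] := ltnP (1 * (2 * N + 1 + p * 2 ^ e)) (6 * N).
  by apply: (@rough_count_large rat 6 1) N_large => //; apply: density41.
apply: leq_ltn_trans (prime_count_rough _ _); [|lia..].
have [/andP[p_le N_small]|not_small] := boolP ((p <= 1024) && (N <= 128 * 128)).
  by apply: prime_count_small => //; [lia|case: ifP; lia].
rewrite leqNgt; apply/negP => D_lt.
have [|s [L [k [y]]]] := half_prime_count _ N_ge D_lt; first lia.
set n := 2 * N./2 => -[/andP[s_le s_gt] /andP[L_le L_gt] kp [y_n y_p] n_le].
have n_N : n <= N <= n + 1 by rewrite /n; lia.
have s_ge a : a * a <= n -> a <= s.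
  by move=> a_n; rewrite leqNgt; apply/negP => sa; have := leq_mul sa sa; lia.
have s_n a : a <= s -> a * s <= n.
  by move=> a_s; apply: leq_trans s_le; rewrite leq_mul2r a_s orbT.
have [n_lt|n_ge] := ltnP n (128 * 128).
  (* Here [N < 2^14], so only [p > 1024] is left by the computation. *)
  have p_gt : 1025 <= p by lia.
  have k_le : 1025 * k <= 2 * n + 3.
    by have := leq_mul (leqnn k) p_gt; lia.
  have L_lt t : n < 2 ^ t -> L.+1 * (s + k) <= t * (s + k).
    move=> n_t; rewrite leq_mul2r -(ltn_exp2l (m := 2)) ?(leq_ltn_trans L_le) //.
    exact: orbT.
  (* Up to constants, the right side of [n_le] is at most n times 2/3 + 12/45 + 24/1025,
     respectively 2/3 + 14/64 + 28/1025, both below 1. *)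
  have [n_lt'|n_ge'] := ltnP n (64 * 64).
    have /s_n : 45 <= s by apply: s_ge; lia.
    by have := L_lt 12; lia.
  have /s_n : 64 <= s by apply: s_ge; lia.
  by have := L_lt 14; lia.
have L_ge : 14 <= L.
  rewrite -ltnS -(ltn_exp2l (m := 2)) //; apply: leq_ltn_trans L_gt.
  by apply: leq_trans n_ge.
have L_s : 17 * L.+1 < 2 * s.+1.
  rewrite ltnNge; apply/negP => s_L; have := leq_mul s_L s_L.
  by have := expn2_ge_square L_ge; lia.
have {}s_n : 128 * s <= n by apply/s_n/s_ge.
have Ls : 17 * (L.+1 * s) <= 2 * n + s.
  have : 17 * L.+1 <= 2 * s + 1 by lia.
  by move=> /leq_mul/(_ (leqnn s)); lia.
have [N_lt|N_ge16] := ltnP N (16 * p).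
  have k_le : k <= 32.
    rewrite leqNgt; apply/negP => k_gt.
    by have := leq_mul k_gt (leqnn p); lia.
  (* The term 32(L + 1) is at most 4s <= n/32, while 2y <= 2n/3 and (L + 1)s is about 2n/17. *)
  have := leq_mul (leqnn L.+1) k_le.
  by move: n_le; rewrite mulnDr; lia.
have L_p : 8 * L.+1 <= 3 * p.
  apply: log_bound (size_sieve_primes p_gt6) _ => //.
  by rewrite -/e !expnS; lia.
(* Relative to N, the three terms 2y, (L + 1)s and (L + 1)k are about 1/8, 2/17 and 3/4 at most,
   with sum below 1. *)
have := leq_mul L_p (leqnn k).
by move: n_le; rewrite mulnDr; lia.
Qed.

Lemma rough_count_ge (p N : nat) : prime p -> 11 <= p -> 2 * p <= N ->
  (2 * N + 1) %/ p < count (rough p) (iota 1 N).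
Proof.
move=> p_pr p_ge N_ge; have [p_lt|p_ge41] := ltnP p 41.
  by apply: rough_count_p_lt41; rewrite ?p_ge.
exact: rough_count_p_ge41.
Qed.

(** * Passage to real n *)

Local Open Scope ring_scope.

Theorem theorem1p1 (R : realType) (p : nat) (n : R)
    (p_prime : prime p) (p_ge11 : (11 <= p)%N) (n_ge : 2 * p%:R <= n) :
  Num.floor (2 * n / p%:R) + 1 <= (Phi n p%:R)%:Z.
Proof.
set N := Num.truncn n.
have p_gt0 : 0 < p%:R :> R by rewrite ltr0n prime_gt0.
have n_ge0 : 0 <= n by rewrite (le_trans _ n_ge) // mulr_ge0.
have N_ge : (2 * p <= N)%N by rewrite truncn_ge_nat // natrM.
have -> : Phi n p%:R = count (rough p) (iota 1 N).
  apply: eq_count => k; apply: eq_all => q.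
  by rewrite ltr_nat -leqNgt.
have := rough_count_ge p_prime p_ge11 N_ge; set C := count _ _ => C_gt.
rewrite lezD1 floor_lt_int -[_%:~R]/(C%:R) ltr_pdivrMr //.
(* The integer bound is stated with [2 * N + 1] to give 2(N + 1) <= C p, which covers every real
   [n < N + 1]. *)
have {C_gt} : 2 * N.+1%:R <= C%:R * p%:R :> R.
  by rewrite -!natrM ler_nat; move: C_gt; rewrite ltn_divLR ?prime_gt0 //; lia.
have := truncnS_gt n; rewrite -/N; lra.
Qed.
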